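(* Let $b_0,b_1,\dotsc$ be integers and suppose that $|b_n|\geq 2$ for $n=1,2,\dotsc$. Then the continued fraction $[b_0,b_1,\dotsc]$ converges to a rational if it has the same tail as $[2,2,\dotsc]$ or $[-2,-2,\dotsc]$, and otherwise it converges to an irrational.
   Context: Let $\mathbb{R}_\infty=\mathbb{R}\cup\{\infty\}$ be the extended real line (one point at infinity). A continued fraction $[b_0,b_1,\dotsc]$ is the negative continued fraction $b_0-\cfrac{1}{b_1-\cfrac{1}{b_2-\dotsb}}$ with integer coefficients. With $s_n(z)=b_n-1/z$ (a Möbius transformation of $\mathbb{R}_\infty$, usual conventions at $0$ and $\infty$) and $S_n=s_0\circ s_1\circ\dotsb\circ s_n$, the $n$th convergent is $v_n=[b_0,\dots,b_n]=S_n(\infty)$. The continued fraction converges, with value $\alpha\in\mathbb{R}_\infty$, if $v_n\to\alpha$ in $\mathbb{R}_\infty$. Two continued fractions $[b_0,b_1,\dotsc]$ and $[c_0,c_1,\dotsc]$ have the same tail if there are positive integers $r,s$ such that the sequences $b_r,b_{r+1},\dotsc$ and $c_s,c_{s+1},\dotsc$ coincide. *)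

(* Defs.v *)
From HB Require Import structures.
From mathcomp Require Import all_boot all_order all_algebra.
From mathcomp Require Import all_classical all_reals all_analysis.

Set Implicit Arguments.
Unset Strict Implicit.
Unset Printing Implicit Defensive.

Import Order.TTheory GRing.Theory Num.Theory.
Import numFieldNormedType.Exports.

Local Open Scope classical_set_scope.
Local Open Scope ring_scope.

(* [Some x] is the real number [x]; [None] is the point at infinity. *)
Notation Rinf R := (one_point_compactification R).

(* Since [0^-1 = 0] in MathComp, the value at 0 is given by hand. *)
Definition cf_step (R : realType) (b : int) (z : Rinf R) : Rinf R :=
  match z with
  | None => Some b%:~R
  | Some x => if x == 0 then None else Some (b%:~R - 1 / x)
  end.

Fixpoint cf_comp (R : realType) (b : nat -> int) (n : nat) : Rinf R -> Rinf R :=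
  match n with
  | 0%N => cf_step (b 0%N)
  | m.+1 => cf_comp b m \o cf_step (b m.+1)
  end.

Definition convergent (R : realType) (b : nat -> int) (n : nat) : Rinf R :=
  cf_comp b n None.

Definition cf_converges_to (R : realType) (b : nat -> int) (alpha : Rinf R) :
  Prop := convergent R b n @[n --> \oo] --> alpha.

Definition same_tail (b c : nat -> int) : Prop :=
  exists r s : nat,
    [/\ (0 < r)%N, (0 < s)%N & forall n : nat, b (r + n)%N = c (s + n)%N].

(* Main.v *)
Require Import Defs.
From HB Require Import structures.
From mathcomp Require Import all_boot all_order all_algebra.
From mathcomp Require Import all_classical all_reals all_analysis.
From mathcomp Require Import zify ring lra.

Set Implicit Arguments.
Unset Strict Implicit.
Unset Printing Implicit Defensive.

Import Order.TTheory GRing.Theory Num.Theory.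
Import numFieldNormedType.Exports.

Local Open Scope ring_scope.

(** Write [P n / Q n] for the quotient of continuants with the index shifted by
one, so that the [n]-th convergent is [P n.+1 / Q n.+1]. Both [P] and [Q] solve
the linear recurrence [D n.+2 = b n.+1 * D n.+1 - D n]. The whole argument rests
on one remark ([norm_step_convex]): since [|b n| >= 2] for [n >= 1], the
sequence [|D n|] is convex for every solution [D]. A convex sequence lies above
its chords' extensions, which gives two opposite behaviours:

- [|Q n|] starts with 0, 1, so it increases strictly and [|Q n| >= n];
- the absolute value of a bounded solution never increases
  ([recurrence_bounded_norm_nonincreasing]).

Consecutive convergents differ by [1 / (Q n.+1 * Q n.+2)] up to sign, which is
at most [1 / |Q n.+1| - 1 / |Q n.+2|]. Hence the convergents have a real limit
[x] and [|x - P n.+1 / Q n.+1| <= 1 / |Q n.+1|]. In other words the residual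
[D n = Q n * x - P n] is a solution bounded by 1 ([cf_value_residual_le1]), so
[|D n|] never increases.

If [d * x = a] with integers [a] and [d != 0], then [d * D n] is an integer
solution, so its absolute value is eventually constant; the constant is not 0
because [P] and [Q] have determinant 1. From then on [D n.+1 = e * D n] with a
sign [e], and the recurrence forces [e] to stay the same and [b n] to be [2 * e]
([constant_tail_of_rational]).

Conversely, if [b n] is eventually [2 * e], then [e ^+ n * D n] is eventually an
arithmetic progression. It is bounded, hence constant, and [D m = e * D m.+1] is
a linear equation in [x] with integer coefficients, whose leading coefficient
[Q m - e * Q m.+1] is nonzero ([rational_of_constant_tail]). *)

(** * Sequences and rational numbers *)

Lemma bounded_slope_le0 (R : archiRealFieldType) (x d M : R) :
  (forall k : nat, x + k%:R * d <= M) -> d <= 0.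
Proof.
move=> xdM; rewrite leNgt; apply/negP => d0.
have xM : 0 <= M - x by have := xdM 0%N; rewrite mul0r addr0 subr_ge0.
have := archi_boundP (divr_ge0 xM (ltW d0)).
rewrite ltr_pdivrMr// ltNge => /negP; apply.
by rewrite lerBrDl.
Qed.

Lemma nonincreasing_nat_stationary (f : nat -> nat) :
  (forall n, (f n.+1 <= f n)%N) -> exists N, forall n, (N <= n)%N -> f n = f N.
Proof.
move=> fS; have fle : {homo f : m n / (m <= n)%N >-> (n <= m)%N}.
  by apply: homo_leq => // m n p mn np; exact: leq_trans np mn.
have [v [N <-] vmin] : exists2 v, (exists N, f N = v) &
    forall n, (v <= f n)%N.
  have exf : exists v, `[< exists N, f N = v >].
    by exists (f 0%N); apply/asboolP; exists 0%N.
  case: (ex_minnP exf) => v /asboolP vP vmin; exists v => // n.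
  by apply: vmin; apply/asboolP; exists n.
exists N => n Nn; apply/eqP; rewrite eqn_leq fle//=; exact: vmin.
Qed.

Lemma rational_of_linear (R : realType) (x : R) (a d : int) :
  d != 0 -> d%:~R * x = a%:~R -> rational x.
Proof.
move=> d0 dxa; exists (a%:~R / d%:~R) => //.
rewrite fmorph_div/= !ratr_int -dxa mulrAC mulfV ?mul1r//.
by rewrite intr_eq0.
Qed.

Lemma rational_linear (R : realType) (x : R) :
  rational x -> exists a d : int, d != 0 /\ d%:~R * x = a%:~R.
Proof.
case=> q _ <-; exists (numq q), (denq q); split; first exact: denq_neq0.
by rewrite /ratr mulrC divfK// intr_eq0 denq_neq0.
Qed.

Local Open Scope classical_set_scope.

(** The intervals of centre [v n] and radius [e n] are nested, so the limit lies
in all of them; this is what turns a bound on steps into an error bound. *)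
Lemma cvg_of_step_le (R : realType) (v e : nat -> R) :
  (forall n, `|v n.+1 - v n| <= e n - e n.+1) -> e @ \oo --> 0 ->
  exists2 x : R, v @ \oo --> x & forall n, `|x - v n| <= e n.
Proof.
move=> ve e0; pose lo := v - e; pose hi := v + e.
have lo_incr : nondecreasing_seq lo.
  apply/nondecreasing_seqP => n; rewrite /lo !fctE.
  by have := ve n; rewrite ler_norml => /andP[? ?]; lra.
have hi_decr : nonincreasing_seq hi.
  apply/nonincreasing_seqP => n; rewrite /hi !fctE.
  by have := ve n; rewrite ler_norml => /andP[? ?]; lra.
have hilo : hi - lo @ \oo --> 0.
  have -> : hi - lo = e + e by apply/funext => n; rewrite /hi /lo !fctE; ring.
  by rewrite -[0 in X in _ --> X]addr0; exact: cvgD.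
have [hiloE clo chi] := adjacent_seq lo_incr hi_decr hilo.
exists (limn lo).
  have -> : v = lo + e by apply/funext => n; rewrite /lo !fctE subrK.
  by rewrite -[X in _ --> X]addr0; exact: cvgD.
move=> n; have := nondecreasing_cvgn_le lo_incr clo n.
have := nonincreasing_cvgn_ge hi_decr chi n; rewrite hiloE /lo /hi !fctE.
by rewrite ler_norml => ? ?; apply/andP; split; lra.
Qed.

(** * Solutions of the three-term recurrence *)

Definition cf_recurrence (R : pzRingType) (b : nat -> int) (D : nat -> R) :=
  forall n, D n.+2 = (b n.+1)%:~R * D n.+1 - D n.

(** Convexity of [|D n|]: the triangle inequality in
[2 * |t| <= |B * t| <= |B * t - s| + |s|]. *)
Lemma norm_step_convex (R : realDomainType) (B : int) (s t : R) :
  2 <= `|B| -> `|t| - `|s| <= `|B%:~R * t - s| - `|t|.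
Proof.
move=> B2; have Bt : 2 * `|t| <= `|B%:~R * t|.
  rewrite normrM; apply: ler_wpM2r => //.
  by rewrite -intr_norm -[2 in leLHS]/(2%:~R) ler_int.
have := ler_normD (B%:~R * t - s) s; rewrite subrK; lra.
Qed.

Lemma unit_intP (e : int) : `|e| = 1 -> e = 1 \/ e = -1.
Proof. by move=> e1; lia. Qed.

(** Once three consecutive terms [s], [t] and [B * t - s] of a solution have
the same nonzero absolute value, dividing by [s] leaves [|B * e - 1| = 1], in
which [|B| >= 2] excludes [B = 0]. The second conclusion says that the sign
[e] is passed on to the next step. *)
Lemma norm_step_stationary (R : realDomainType) (B e : int) (s t : R) :
  2 <= `|B| -> `|e| = 1 -> s != 0 -> t = e%:~R * s ->
  `|B%:~R * t - s| = `|s| -> B = 2 * e /\ B%:~R * t - s = e%:~R * t.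
Proof.
move=> B2 e1 s0 -> Bst; have {Bst}Be : `|B * e - 1| = 1.
  apply: (@intr_inj R); apply: (@mulIf _ `|s|); first by rewrite normr_eq0.
  rewrite mul1r -[RHS]Bst intr_norm -normrM; congr `|_|.
  by rewrite intrB intrM mulrBl mul1r mulrA.
have ->: B = 2 * e by case: (unit_intP e1) Be => ->; lia.
by split=> //; case: (unit_intP e1) => ->; ring.
Qed.

Section Recurrence.
Variables (b : nat -> int) (hb : forall n : nat, (1 <= n)%N -> 2 <= `|b n|).

(** By convexity, later increments of [|D n|] are at least the one at [m]. *)
Lemma recurrence_norm_growth (R : realDomainType) (D : nat -> R) (m k : nat) :
  cf_recurrence b D ->
  `|D m| + k%:R * (`|D m.+1| - `|D m|) <= `|D (m + k)%N|.
Proof.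
move=> recD; set d := _ - _.
have incr i : d <= `|D (m + i).+1| - `|D (m + i)%N|.
  elim: i => [|i IH]; first by rewrite addn0.
  rewrite addnS recD; apply: (le_trans IH); exact: norm_step_convex (hb _).
elim: k => [|k IH]; first by rewrite mul0r addr0 addn0.
by rewrite addnS -natr1 mulrDl mul1r; have := incr k; lra.
Qed.

(** One positive increment would make [|D n|] grow linearly. *)
Lemma recurrence_bounded_norm_nonincreasing (R : archiRealFieldType)
    (D : nat -> R) (M : R) :
  cf_recurrence b D -> (forall n, `|D n| <= M) ->
  forall n, `|D n.+1| <= `|D n|.
Proof.
move=> recD DM n; rewrite -subr_le0; apply: bounded_slope_le0 => k.
exact: le_trans (recurrence_norm_growth n k recD) (DM _).
Qed.

Lemma recurrence_stationary_tail (R : realDomainType) (D : nat -> R) (N : nat) :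
  cf_recurrence b D -> (forall n, (N <= n)%N -> `|D n| = `|D N|) -> D N != 0 ->
  exists2 e : int, `|e| = 1 & forall k, b (N + k).+1 = 2 * e.
Proof.
move=> recD Dst DN0.
have Dn0 k : D (N + k)%N != 0 by rewrite -normr_gt0 Dst ?leq_addr// normr_gt0.
have [e e1 De0] : exists2 e : int, `|e| = 1 & D N.+1 = e%:~R * D N.
  have /eqP := Dst _ (leqnSn N); rewrite eqr_norm2 => /orP[|] /eqP ->.
    by exists 1; [rewrite normr1|rewrite mul1r].
  by exists (-1); [rewrite normrN1|rewrite mulN1r].
have step k : D (N + k).+1 = e%:~R * D (N + k)%N ->
    b (N + k).+1 = 2 * e /\ D (N + k).+2 = e%:~R * D (N + k).+1.
  move=> De; rewrite recD; apply: norm_step_stationary => //; first exact: hb.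
  by rewrite -recD !Dst// -?addnS leq_addr.
suff De k : D (N + k).+1 = e%:~R * D (N + k)%N.
  by exists e => // k; have [] := step k (De k).
elim: k => [|k IH]; first by rewrite addn0.
by rewrite addnS; have [] := step k IH.
Qed.

(** The sequence [e ^+ k * D (m + k)] solves the recurrence with constant
coefficient 2, so it is an arithmetic progression, of common difference [- d].
Boundedness on both sides forces [d = 0]. *)
Lemma recurrence_constant_tail (R : archiRealFieldType) (D : nat -> R) (M : R)
    (m : nat) (e : int) :
  `|e| = 1 -> cf_recurrence b D -> (forall n, `|D n| <= M) ->
  (forall k, b (m + k).+1 = 2 * e) -> D m = e%:~R * D m.+1.
Proof.
move=> e1 recD DM be; set d := D m - e%:~R * D m.+1.
have e2 : e%:~R * e%:~R = 1 :> R.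
  by case: (unit_intP e1) => ->; rewrite ?mulrNN mulr1.
pose G k := e%:~R ^+ k * D (m + k)%N.
(* Two consecutive terms at a time, since the recurrence has order two. *)
have GE k : G k = D m - k%:R * d /\ G k.+1 = D m - k.+1%:R * d.
  elim: k => [|k [IH1 IH2]].
    by rewrite /G expr0 expr1 addn0 addn1 /d; split; ring.
  split=> //; transitivity (2 * G k.+1 - G k); last first.
    by rewrite IH1 IH2 -!natr1; ring.
  rewrite /G !addnS recD be intrM !exprS.
  transitivity ((e%:~R * e%:~R) * (2 * (e%:~R * e%:~R ^+ k * D (m + k).+1))
     - (e%:~R * e%:~R) * (e%:~R ^+ k * D (m + k)%N) : R); first by ring.
  by rewrite e2 !mul1r.
have GM k : `|D m - k%:R * d| <= M.
  have [<- _] := GE k; rewrite /G normrM normrX -intr_norm e1 expr1n mul1r.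
  exact: DM.
apply/eqP; rewrite -subr_eq0 -/d eq_le; apply/andP; split.
  apply: (@bounded_slope_le0 _ (- D m) _ M) => k.
  by have := GM k; rewrite ler_norml => /andP[? ?]; lra.
rewrite -oppr_le0; apply: (@bounded_slope_le0 _ (D m) _ M) => k.
by have := GM k; rewrite ler_norml => /andP[? ?]; lra.
Qed.

End Recurrence.

(** * Convergents and the value of the continued fraction *)

(** The pair of terms of indices [n] and [n.+1] of the solution that starts
with [u, v]; carrying the pair makes the recursion structural. *)
Fixpoint continuants (b : nat -> int) (u v : int) (n : nat) : int * int :=
  if n is m.+1 then
    let: (s, t) := continuants b u v m in (t, b n * t - s)
  else (u, v).

(** The starting values are those at indices -1 and 0 in the usual numbering,
so the [n]-th convergent is [cf_num b n.+1 / cf_den b n.+1]. *)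
Definition cf_num (b : nat -> int) (n : nat) : int :=
  (continuants b 1 (b 0) n).1.
Definition cf_den (b : nat -> int) (n : nat) : int :=
  (continuants b 0 1 n).1.

Lemma continuants_recurrence (b : nat -> int) (u v : int) (n : nat) :
  (continuants b u v n.+2).1
  = b n.+1 * (continuants b u v n.+1).1 - (continuants b u v n).1.
Proof. by move=> /=; case: (continuants b u v n). Qed.

Lemma cf_num_recurrence (b : nat -> int) (n : nat) :
  cf_num b n.+2 = b n.+1 * cf_num b n.+1 - cf_num b n.
Proof. exact: continuants_recurrence. Qed.

Lemma cf_den_recurrence (b : nat -> int) (n : nat) :
  cf_den b n.+2 = b n.+1 * cf_den b n.+1 - cf_den b n.
Proof. exact: continuants_recurrence. Qed.

Lemma cf_det (b : nat -> int) (n : nat) :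
  cf_num b n * cf_den b n.+1 - cf_num b n.+1 * cf_den b n = 1.
Proof.
elim: n => [|n IH]; first by rewrite mulr0 subr0.
by rewrite cf_num_recurrence cf_den_recurrence -IH; ring.
Qed.

Section Convergence.
Variables (R : realType) (b : nat -> int).
Hypothesis hb : forall n : nat, (1 <= n)%N -> 2 <= `|b n|.

Local Notation P n := ((cf_num b n)%:~R : R).
Local Notation Q n := ((cf_den b n)%:~R : R).

(** The composite of the first steps is the Moebius map of the matrix of
continuants. The steps [x |-> b n - 1 / x] with [n >= 1] preserve the set
[1 <= |x|], so the special values at 0 and at infinity never intervene. *)
Lemma cf_comp_some (n : nat) (x : R) : 1 <= `|x| ->
  cf_comp b n (Some x) = Some ((P n.+1 * x - P n) / (Q n.+1 * x - Q n)).
Proof.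
elim: n x => [|n IH] x x1; have x0 : x != 0 by rewrite -normr_gt0; lra.
  rewrite /= (negbTE x0); congr Some.
  by rewrite /cf_num /cf_den /= mul1r subr0; field.
rewrite /= (negbTE x0) IH; last first.
  have bn : 2 <= `|(b n.+1)%:~R : R|.
    by rewrite -intr_norm -[2 in leLHS]/(2%:~R) ler_int hb.
  have x1' : `|1 / x| <= 1 by rewrite normrM normr1 mul1r normfV invf_le1; lra.
  have := ler_normB ((b n.+1)%:~R - 1 / x) (- (1 / x)).
  by rewrite opprK subrK normrN; lra.
congr Some; rewrite cf_num_recurrence cf_den_recurrence !intrB !intrM.
set A := _ - P n; set C := _ - Q n; transitivity ((A * x) / (C * x)).
  by rewrite -mulf_div divff// mulr1.
by congr (_ / _); rewrite /A /C; field.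
Qed.

Lemma convergentE (n : nat) : convergent R b n = Some (P n.+1 / Q n.+1).
Proof.
case: n => [|n]; first by rewrite /convergent /cf_num /cf_den /= divr1.
rewrite /convergent /= cf_comp_some; last first.
  rewrite -intr_norm -[1 in leLHS]/(1%:~R) ler_int.
  by have := hb (ltn0Sn n); lia.
rewrite cf_num_recurrence cf_den_recurrence !intrB !intrM.
by rewrite ![_ * (b n.+1)%:~R]mulrC.
Qed.

Lemma cf_den_norm_lt (n : nat) : `|cf_den b n| < `|cf_den b n.+1|.
Proof.
elim: n => [//|n IH]; rewrite cf_den_recurrence.
have := norm_step_convex (cf_den b n) (cf_den b n.+1) (hb (ltn0Sn n)).
rewrite intz; lia.
Qed.

Lemma cf_den_norm_ge (n : nat) : n%:Z <= `|cf_den b n|.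
Proof. by elim: n => [//|n IH]; have := cf_den_norm_lt n; lia. Qed.

(** For [x] the value of the continued fraction this is, up to sign, the product
of the inverses of its complete quotients of indices 1 to [n]. *)
Definition cf_residual (x : R) (n : nat) : R := Q n * x - P n.

Lemma cf_residual_recurrence (x : R) : cf_recurrence b (cf_residual x).
Proof.
by move=> n; rewrite /cf_residual cf_num_recurrence cf_den_recurrence
  !intrB !intrM; ring.
Qed.

(** As [|Q n|] increases by at least 1 at each step, the determinant identity
bounds the step between convergents by a telescoping difference, with
[1 / |Q n.+1|] as error bound. *)
Lemma cf_value_residual_le1 : exists2 x : R,
  cf_converges_to b (Some x : Rinf R) & forall n, `|cf_residual x n| <= 1.
Proof.
have Q0 n : 0 < `|Q n.+1|.
  rewrite -intr_norm ltr0z; have := cf_den_norm_lt n; lia.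
have QN0 n : Q n.+1 != 0 by rewrite -normr_gt0.
pose v n := P n.+1 / Q n.+1; pose e n := `|Q n.+1|^-1.
have ve n : `|v n.+1 - v n| <= e n - e n.+1.
  have -> : v n.+1 - v n = - (Q n.+1 * Q n.+2)^-1.
    apply: (@mulIf _ (Q n.+1 * Q n.+2)); first by rewrite mulf_neq0.
    rewrite mulNr mulVf ?mulf_neq0//.
    have det : P n.+1 * Q n.+2 - P n.+2 * Q n.+1 = 1.
      by rewrite -!intrM -intrB cf_det.
    by rewrite -[in RHS]det /v; field; rewrite !QN0.
  rewrite normrN normfV normrM.
  have -> : e n - e n.+1 = (`|Q n.+2| - `|Q n.+1|) / (`|Q n.+1| * `|Q n.+2|).
    by rewrite /e; field; rewrite !gt_eqF.
  rewrite -[leLHS]mul1r ler_wpM2r ?invr_ge0 ?mulr_ge0//.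
  rewrite -!intr_norm -intrB -[1 in leLHS]/(1%:~R) ler_int.
  by have := cf_den_norm_lt n.+1; lia.
(* Comparison with the harmonic sequence, as |Q n.+1| >= n.+1. *)
have e0 : e @ \oo --> 0.
  apply: (@squeeze_cvgr _ _ _ _ (fun=> 0) harmonic).
  - near=> n; rewrite /e invr_ge0 normr_ge0/= lef_pV2 ?posrE//.
    by rewrite -intr_norm -[n.+1%:R]/(n.+1%:Z%:~R) ler_int cf_den_norm_ge.
  - exact: cvg_cst.
  - exact: cvg_harmonic.
have [x vx xe] := cvg_of_step_le ve e0; exists x.
  rewrite /cf_converges_to.
  have -> : convergent R b = Some \o v.
    by apply/funext => n; rewrite convergentE.
  apply: (cvg_comp _ _ vx); exact: one_point_compactification_some_continuous.
case=> [|n]; first by rewrite /cf_residual mul0r sub0r normrN normr1.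
have -> : cf_residual x n.+1 = Q n.+1 * (x - v n).
  by rewrite /cf_residual /v; field; rewrite QN0.
by rewrite normrM -ler_pdivlMl// mulr1; exact: xe.
Unshelve. all: by end_near. Qed.

(** * Rational values and constant tails *)

(** The relation between consecutive residuals is the linear equation in [x];
its leading coefficient is nonzero as [|Q n|] is strictly increasing. *)
Lemma rational_of_constant_tail (x : R) (e : int) :
  `|e| = 1 -> (forall n, `|cf_residual x n| <= 1) ->
  same_tail b (fun=> 2 * e) -> rational x.
Proof.
move=> e1 Dx [[|m] [s [// _ _ be]]].
have DE := recurrence_constant_tail e1 (@cf_residual_recurrence x) Dx be.
apply: (@rational_of_linear _ _ (cf_num b m - e * cf_num b m.+1)
  (cf_den b m - e * cf_den b m.+1)).
  by have := cf_den_norm_lt m; case: (unit_intP e1) => ->; lia.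
by move: DE; rewrite /cf_residual !intrB !intrM => DE; lra.
Qed.

(** The descent: multiplied by a denominator of [x], the residuals become
integers whose absolute values never increase. *)
Lemma constant_tail_of_rational (x : R) :
  (forall n, `|cf_residual x n| <= 1) -> rational x ->
  exists2 e : int, `|e| = 1 & same_tail b (fun=> 2 * e).
Proof.
move=> Dx /rational_linear[a [d [d0 dxa]]].
pose z n := cf_den b n * a - cf_num b n * d.
have zE n : (z n)%:~R = d%:~R * cf_residual x n :> R.
  by rewrite /z /cf_residual intrB !intrM -dxa; ring.
have z_rec : cf_recurrence b z.
  by move=> n; rewrite /z cf_num_recurrence cf_den_recurrence intz; ring.
have zS n : (`|z n.+1| <= `|z n|)%N.
  rewrite -lez_nat !abszE -(ler_int R) !intr_norm !zE !normrM ler_wpM2l//.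
  have recD := @cf_residual_recurrence x.
  exact: (recurrence_bounded_norm_nonincreasing hb recD Dx).
have [N zN] := nonincreasing_nat_stationary zS.
have zN_norm n : (N <= n)%N -> `|z n| = `|z N|.
  by move=> /zN; rewrite -!abszE => ->.
(* Otherwise the next term vanishes too, against the determinant being 1. *)
have zN0 : z N != 0.
  apply/eqP => z0; have := zN_norm _ (leqnSn N).
  rewrite z0 normr0 => /eqP; rewrite normr_eq0 => /eqP z1.
  have : d * 1 = 0.
    rewrite -(cf_det b N).
    transitivity (cf_den b N * z N.+1 - cf_den b N.+1 * z N).
      by rewrite /z; ring.
    by rewrite z0 z1 !mulr0 subr0.
  by rewrite mulr1 => /eqP; rewrite (negbTE d0).
have [e e1 be] := recurrence_stationary_tail hb z_rec zN_norm zN0.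
by exists e => //; exists N.+1, 1%N; split.
Qed.

End Convergence.

Theorem theorem1p2 (R : realType) (b : nat -> int)
    (hb : forall n : nat, (1 <= n)%N -> 2 <= `|b n|) :
  (same_tail b (fun=> 2) \/ same_tail b (fun=> - 2) ->
     exists2 x : R, rational x & cf_converges_to b (Some x : Rinf R)) /\
  (~ (same_tail b (fun=> 2) \/ same_tail b (fun=> - 2)) ->
     exists2 x : R, irrational x & cf_converges_to b (Some x : Rinf R)).
Proof.
have [x bx Dx] := cf_value_residual_le1 R hb.
split=> [tail|no_tail]; exists x => //.
  case: tail => tail.
    exact: (@rational_of_constant_tail _ _ hb x 1).
  exact: (@rational_of_constant_tail _ _ hb x (-1)).
move=> /(constant_tail_of_rational hb Dx)[e /unit_intP[] -> tail].
  by apply: no_tail; left.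
by apply: no_tail; right.
Qed.
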